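(* Let $\mu,\nu,P_f^0,P_f^1,P_m\in(0,1)$, and let $\mathbf p=(P_0,P_1,P_2,P_3)^{\mathbf T}$ be the steady-state probability vector ($\mathbf\Psi\mathbf p=\mathbf p$, $\sum_{k=0}^3P_k=1$) of the four-state system Markov chain with transition matrix $\mathbf\Psi$ given in the context. Put $\xi=1-P_f^0+P_f^1$ and $P_{idle}=P_0+P_2$. Then the spectrum waste ratio $$P_w=\frac{P_0+\frac12\,\frac{\mu\nu}{\mu+\nu}}{P_{idle}}$$ equals $$P_w=\frac{\mu}{2}+\frac{\left(\frac1\mu-1\right)P_f^1+1-P_m}{1+\left(\frac1\mu-1\right)\xi}.$$
   Context: Model: time is slotted. A primary user (PU) is either idle or busy; if idle it becomes busy in a slot with probability $\mu$, if busy it becomes idle with probability $\nu$. A secondary user (SU) is either silent or transmitting; at the end of each slot it senses the channel, transmits in the next slot if it judges the PU absent, and stays silent otherwise. $P_f^0$ and $P_f^1$ are the false-alarm probabilities of sensing when the SU is silent and transmitting, respectively, and $P_m$ is the miss-detection probability, taken equal in both cases. The system states are $S_0$ (PU idle, SU silent: spectrum waste), $S_1$ (PU busy, SU silent), $S_2$ (PU idle, SU transmitting), $S_3$ (PU busy, SU transmitting: collision). With $\mathbf\Psi_{ij}$ denoting the probability of moving from $S_j$ to $S_i$ ($i,j=0,1,2,3$), $$\mathbf\Psi=\begin{pmatrix} P_f^0(1-\mu)&(1-P_m)\nu&P_f^1(1-\mu)&(1-P_m)\nu\\ P_f^0\mu&(1-P_m)(1-\nu)&P_f^1\mu&(1-P_m)(1-\nu)\\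 (1-P_f^0)(1-\mu)&P_m\nu&(1-P_f^1)(1-\mu)&P_m\nu\\ (1-P_f^0)\mu&P_m(1-\nu)&(1-P_f^1)\mu&P_m(1-\nu) \end{pmatrix}.$$ The spectrum waste ratio combines full-slot waste (probability $P_0$) and waste of average length half a slot in slots where the PU departs (occurrence probability $\frac{\mu\nu}{\mu+\nu}$), normalized by the probability $P_{idle}$ that the PU is idle. *)

(* Defs.v *)
From HB Require Import structures.
From mathcomp Require Import all_boot all_order all_algebra.

Set Implicit Arguments.
Unset Strict Implicit.
Unset Printing Implicit Defensive.

Import Order.TTheory GRing.Theory Num.Theory.
Local Open Scope ring_scope.

(* PU idle, SU silent (spectrum waste). *)
Definition S0 : 'I_4 := @Ordinal 4 0 isT.
(* PU busy, SU silent. *)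
Definition S1 : 'I_4 := @Ordinal 4 1 isT.
(* PU idle, SU transmitting. *)
Definition S2 : 'I_4 := @Ordinal 4 2 isT.
(* PU busy, SU transmitting (collision). *)
Definition S3 : 'I_4 := @Ordinal 4 3 isT.

(* Column-stochastic convention: entry (i, j) is the probability of moving
   from S_j to S_i, so distributions are column vectors acted on from the
   left.  Pf0 and Pf1 are the false-alarm probabilities with the SU silent and
   transmitting; Pm is the miss-detection probability. *)
Definition Psi (R : realFieldType) (mu nu Pf0 Pf1 Pm : R) : 'M[R]_4 :=
  \matrix_(i < 4, j < 4) nth 0 (nth [::]
    [:: [:: Pf0 * (1 - mu); (1 - Pm) * nu;
            Pf1 * (1 - mu); (1 - Pm) * nu];
        [:: Pf0 * mu; (1 - Pm) * (1 - nu);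
            Pf1 * mu; (1 - Pm) * (1 - nu)];
        [:: (1 - Pf0) * (1 - mu); Pm * nu;
            (1 - Pf1) * (1 - mu); Pm * nu];
        [:: (1 - Pf0) * mu; Pm * (1 - nu);
            (1 - Pf1) * mu; Pm * (1 - nu)]] i) j.

(* Nonnegativity of p is not required: the two conditions below already
   determine p for the chain above. *)
Definition steady_state (R : realFieldType) (A : 'M[R]_4) (p : 'cV[R]_4) :
    Prop :=
  A *m p = p /\ \sum_(k < 4) p k 0 = 1.

Definition P_idle (R : realFieldType) (p : 'cV[R]_4) : R := p S0 0 + p S2 0.

(* Full-slot waste, plus half a slot of waste on average in each slot where
   the PU departs (such slots occur with probability mu nu / (mu + nu)),
   relative to the time the PU is idle. *)
Definition spectrum_waste_ratio (R : realFieldType) (mu nu : R)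
    (p : 'cV[R]_4) : R :=
  (p S0 0 + 1 / 2 * (mu * nu / (mu + nu))) / P_idle p.

(* Main.v *)
Require Import Defs.
From HB Require Import structures.
From mathcomp Require Import all_boot all_order all_algebra.
From mathcomp Require Import ring lra.

(** The idle probability of the PU evolves autonomously: summing rows 0 and 2 of
    the balance equations gives [mu * P_idle = nu * (1 - P_idle)], hence
    [P_idle = nu / (mu + nu)], and the half-slot term contributes [mu / 2].
    Substituting [P2 = P_idle - P0] and [nu * (P1 + P3) = mu * P_idle] in row 0
    leaves a linear equation for [P0 / P_idle]. *)

Set Implicit Arguments.
Unset Strict Implicit.
Unset Printing Implicit Defensive.

Import Order.TTheory GRing.Theory Num.Theory.
Local Open Scope ring_scope.

Lemma sum_ord4 (V : nmodType) (F : 'I_4 -> V) :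
  \sum_(k < 4) F k = F S0 + F S1 + F S2 + F S3.
Proof.
rewrite !big_ord_recr big_ord0 /= add0r.
by congr (F _ + F _ + F _ + F _); apply: val_inj.
Qed.

Section Balance.

Variables (R : realFieldType) (mu nu Pf0 Pf1 Pm : R) (p : 'cV[R]_4).
Hypothesis hp : steady_state (Psi mu nu Pf0 Pf1 Pm) p.

Lemma steady_state_total : p S0 0 + p S1 0 + p S2 0 + p S3 0 = 1.
Proof. by case: hp => _ <-; rewrite sum_ord4. Qed.

Lemma steady_state_row0 :
  p S0 0 = Pf0 * (1 - mu) * p S0 0 + (1 - Pm) * nu * p S1 0
         + Pf1 * (1 - mu) * p S2 0 + (1 - Pm) * nu * p S3 0.
Proof. by case: hp => + _ => {1}<-; rewrite mxE sum_ord4 !mxE. Qed.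

Lemma steady_state_row2 :
  p S2 0 = (1 - Pf0) * (1 - mu) * p S0 0 + Pm * nu * p S1 0
         + (1 - Pf1) * (1 - mu) * p S2 0 + Pm * nu * p S3 0.
Proof. by case: hp => + _ => {1}<-; rewrite mxE sum_ord4 !mxE. Qed.

(** When rows 0 and 2 are added, [Pf0], [Pf1] and [Pm] cancel: sensing does not influence the PU. *)
Lemma P_idle_balance : (mu + nu) * P_idle p = nu.
Proof.
rewrite /P_idle; have := steady_state_total.
by have := steady_state_row0; have := steady_state_row2; nra.
Qed.

(** Kept free of division; dividing both coefficients by [mu] yields the fraction in the final
    formula. *)
Lemma P0_balance :
  (mu + (1 - mu) * (1 - Pf0 + Pf1)) * p S0 0 =
  ((1 - mu) * Pf1 + mu * (1 - Pm)) * P_idle p.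
Proof.
(* In equilibrium the PU departs as often as it arrives. *)
have busy : nu * (p S1 0 + p S3 0) = mu * P_idle p.
  have := P_idle_balance; have := steady_state_total.
  by rewrite /P_idle; nra.
have row0 : p S0 0 = (1 - mu) * (Pf0 * p S0 0 + Pf1 * p S2 0)
                   + (1 - Pm) * (nu * (p S1 0 + p S3 0)).
  by rewrite {1}steady_state_row0; ring.
by move: row0; rewrite busy /P_idle => row0; lra.
Qed.

End Balance.

Theorem mainTheorem5 (R : realFieldType) (mu nu Pf0 Pf1 Pm : R)
    (p : 'cV[R]_4)
    (hmu : 0 < mu < 1) (hnu : 0 < nu < 1)
    (hPf0 : 0 < Pf0 < 1) (hPf1 : 0 < Pf1 < 1) (hPm : 0 < Pm < 1)
    (hp : steady_state (Psi mu nu Pf0 Pf1 Pm) p) :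
  let xi := 1 - Pf0 + Pf1 in
  spectrum_waste_ratio mu nu p =
    mu / 2 + ((1 / mu - 1) * Pf1 + 1 - Pm) / (1 + (1 / mu - 1) * xi).
Proof.
move=> xi.
have mu0 : mu != 0 by apply: lt0r_neq0; lra.
have nu0 : nu != 0 by apply: lt0r_neq0; lra.
have munu0 : mu + nu != 0 by apply: lt0r_neq0; lra.
(* Both terms are positive: [xi > 0] because [Pf0 < 1] and [Pf1 > 0]. *)
have D0 : mu + (1 - mu) * xi != 0 by apply: lt0r_neq0; rewrite /xi; nra.
have idleE : P_idle p = nu / (mu + nu).
  by rewrite -{1}(P_idle_balance hp) mulrC mulKf.
have P0E : p S0 0 =
    ((1 - mu) * Pf1 + mu * (1 - Pm)) * P_idle p / (mu + (1 - mu) * xi).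
  by rewrite -(P0_balance hp) mulrC mulKf.
rewrite /spectrum_waste_ratio P0E idleE.
(* In this form the denominator is nonzero by [mu0] and [D0], as [field] requires. *)
have -> : 1 + (1 / mu - 1) * xi = (mu + (1 - mu) * xi) / mu by field.
by field; rewrite mu0 nu0 munu0 D0.
Qed.
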